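(* Let $\mathcal{A}\subseteq\mathbb{R}^n$ be a non-empty finite set and let $(A,\beta)\in I(\mathcal{A})$ be a circuit whose barycentric coordinates $\lambda_\alpha$, $\alpha\in A$, are rational, with smallest common denominator $p$ and $m=\lceil\log_2 p\rceil$. Then the dual cone $(P^{\mathrm{even}}_{A,\beta})^*\subseteq\mathbb{R}^{A\cup\{\beta\}}$ of the cone of non-negative even AG functions supported on $(A,\beta)$ is the projection of the spectrahedron $$\left\{(\mathbf{v},\mathbf{y})\in\mathbb{R}^{\mathcal{A}}\times\mathbb{R}^{2^{m}-2}\ :\ C^*_{A,\beta}(\mathbf{v}_{|A},v_\beta,\mathbf{y})\succeq 0\right\}$$ on the coordinates $(\mathbf{v}_{|A},v_\beta)$. Moreover, $(P^{\mathrm{even}}_{A,\beta})^*$ is second-order representable.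
   Context: $\mathbb{N}=\{0,1,2,\dots\}$, $[r]=\{1,\dots,r\}$, $\succeq 0$ means positive semidefinite, $\mathbf{v}_{|A}$ is the restriction of $\mathbf{v}$ to coordinates indexed by $A$. Circuits: $I(\mathcal{A})$ is the set of pairs $(A,\beta)$ with $A\subseteq\mathcal{A}$ affinely independent and $\beta\in\operatorname{relint}(\operatorname{conv}A)\cap(\mathcal{A}\setminus A)$. The barycentric coordinates $\lambda=(\lambda_\alpha)_{\alpha\in A}$ are the unique numbers with $\sum_{\alpha\in A}\lambda_\alpha\alpha=\beta$, $\sum_{\alpha\in A}\lambda_\alpha=1$ (all are positive). Write $\lambda_\alpha=p_\alpha/p$ with $p_\alpha,p\in\mathbb{N}$ and $p$ minimal; $m=\lceil\log_2 p\rceil$. Even AG cone: $P^{\mathrm{even}}_{A,\beta}$ is the cone of functions $f(\mathbf{x})=\sum_{\alpha\in A}c_\alpha|\mathbf{x}|^\alpha+c_\beta|\mathbf{x}|^\beta$ with $c_\alpha\ge 0$ for $\alpha\in A$, $c_\beta\in\mathbb{R}$, and $f(\mathbf{x})\ge 0$ for all $\mathbf{x}\in\mathbb{R}^n$, where $|\mathbf{x}|^\alpha=\prod_j|x_j|^{\alpha_j}$ (set to $\infty$ if some $x_j=0$ has negative exponent). Non-negativity of $f$ is equivalent to non-negativity of the exponential sum $\mathbf{y}\mapsto\sum_{\alpha\in A}c_\alpha\exp(\alpha^T\mathbf{y})+c_\beta\exp(\beta^T\mathbf{y})$ on $\mathbb{R}^n$. Its dual cone is the set of $\mathbf{v}\in\mathbb{R}^{A\cup\{\beta\}}$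 with $\sum_{\alpha\in A\cup\{\beta\}}v_\alpha c_\alpha\ge 0$ for all coefficient vectors of elements $f\in P^{\mathrm{even}}_{A,\beta}$. Dual circuit matrix: the variables are $\mathbf{y}=(y_{k,i})$, $k\in[m-1]$, $i\in[2^{m-k}]$ ($2^m-2$ variables in total). $C^*_{A,\beta}(\mathbf{v}_{|A},v_\beta,\mathbf{y})$ is the block diagonal matrix with the blocks (i) $\begin{pmatrix} y_{k-1,2i-1} & y_{k,i} \\ y_{k,i} & y_{k-1,2i} \end{pmatrix}$ for $k\in\{2,\dots,m-1\}$, $i\in[2^{m-k}]$; (ii) $\begin{pmatrix} y_{m-1,1} & v_\beta \\ v_\beta & y_{m-1,2} \end{pmatrix}$; (iii) the $1\times1$ block $(v_\beta)$; (iv) $2^{m-1}$ blocks $\begin{pmatrix} u & y_{1,l} \\ y_{1,l} & w \end{pmatrix}$, $l\in[2^{m-1}]$, where in each block $u,w$ are variables from $\{v_\alpha:\alpha\in A\}\cup\{v_\beta\}$, arranged such that over all these blocks each $v_\alpha$ ($\alpha\in A$) appears exactly $p_\alpha$ times and $v_\beta$ appears exactly $2^m-p$ times (any such arrangement may be fixed). If $p=2$ (so $m=1$, $A=\{\alpha_1,\alpha_2\}$ and there are no variables $y_{k,i}$), the matrix consists of the single $2\times 2$ block $\begin{pmatrix} v_{\alpha_1} & v_\beta \\ v_\beta & v_{\alpha_2} \end{pmatrix}$ and the block $(v_\beta)$. A subset of $\mathbb{R}^N$ is second-order representable if it is a projection of the feasible set of a second-order cone program, i.e. of a set of the form $\{\mathbf{x}:\|A_i\mathbf{x}+\mathbf{b}_i\|_2\le\mathbf{c}_i^T\mathbf{x}+d_i,\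 i\in[M]\}$ with real matrices $A_i$, vectors $\mathbf{b}_i,\mathbf{c}_i$ and reals $d_i$. *)

(* Defs.v *)
From HB Require Import structures.
From mathcomp Require Import all_boot all_order all_algebra.
From mathcomp Require Import finmap.
From mathcomp Require Import all_classical all_reals all_analysis.

Set Implicit Arguments.
Unset Strict Implicit.
Unset Printing Implicit Defensive.

Import Order.TTheory GRing.Theory Num.Theory.
Import numFieldNormedType.Exports.

Local Open Scope classical_set_scope.
Local Open Scope ring_scope.

(* For a finite set X, the space R^X is {ffun X -> R}. The default value 0 is
   never used when k belongs to X. *)
Definition coordinate (R : realType) (K : choiceType) (X : {fset K})
    (x : {ffun X -> R}) (k : K) : R :=
  oapp x 0 (insub k).

Definition restrict_coordinates (R : realType) (K : choiceType) (X Y : {fset K})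
    (x : {ffun X -> R}) : {ffun Y -> R} :=
  [ffun k : Y => coordinate x (val k)].

Definition affine_hull (R : realType) (n : nat) (S : set 'rV[R]_n) :
    set 'rV[R]_n :=
  [set x | exists k (l : 'I_k -> R) (s : 'I_k -> 'rV[R]_n),
    [/\ forall i, S (s i), \sum_i l i = 1 & x = \sum_i l i *: s i]].

Definition convex_hull (R : realType) (n : nat) (S : set 'rV[R]_n) :
    set 'rV[R]_n :=
  [set x | exists k (l : 'I_k -> R) (s : 'I_k -> 'rV[R]_n),
    [/\ forall i, S (s i), forall i, 0 <= l i, \sum_i l i = 1 &
        x = \sum_i l i *: s i]].

Definition relint (R : realType) (n : nat) (S : set 'rV[R]_n) :
    set 'rV[R]_n :=
  [set x | S x /\ \forall y \near within (affine_hull S) (nbhs x), S y].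

Definition affinely_independent (R : realType) (n : nat)
    (A : {fset 'rV[R]_n}) : Prop :=
  forall c : {ffun A -> R},
    \sum_a c a = 0 -> \sum_a c a *: val a = 0 -> forall a, c a = 0.

(* The set I(AA). *)
Definition circuits (R : realType) (n : nat) (AA : {fset 'rV[R]_n}) :
    set ({fset 'rV[R]_n} * 'rV[R]_n) :=
  [set Ab | [/\ (Ab.1 `<=` AA)%fset, affinely_independent Ab.1,
                relint (convex_hull [set` Ab.1]) Ab.2 &
                Ab.2 \in (AA `\` Ab.1)%fset]].

Definition barycentric (R : realType) (n : nat) (A : {fset 'rV[R]_n})
    (beta : 'rV[R]_n) (lam : {ffun A -> R}) : Prop :=
  \sum_a lam a *: val a = beta /\ \sum_a lam a = 1.

Definition common_denominator (R : realType) (T : finType)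
    (lam : {ffun T -> R}) (q : nat) : Prop :=
  (0 < q)%N /\ forall a, exists k : nat, lam a = k%:R / q%:R.

Definition smallest_common_denominator (R : realType) (T : finType)
    (lam : {ffun T -> R}) (p : nat) : Prop :=
  common_denominator lam p /\
  forall q, common_denominator lam q -> (p <= q)%N.

(* |x|^alpha; recall that 0 `^ 0 = 1. *)
Definition abs_monomial (R : realType) (n : nat) (alpha x : 'rV[R]_n) :
    \bar R :=
  if [exists j, (x 0 j == 0) && (alpha 0 j < 0)] then +oo%E
  else (\prod_j `|x 0 j| `^ alpha 0 j)%:E.

(* The function with coefficient vector c. Its values are meant in
   R \cup {+oo}: the sum is the dual addition of extended reals, for which
   +oo + -oo = +oo, and 0 * +oo = 0. With the other convention
   (+oo + -oo = -oo), the function |x|^(-2) + 1 - 2 |x|^(-1) would be negative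
   at 0 although its exponential sum is a square. *)
Definition AG_function (R : realType) (n : nat) (A : {fset 'rV[R]_n})
    (beta : 'rV[R]_n) (c : {ffun (beta |` A)%fset -> R}) :
    'rV[R]_n -> \bar R :=
  fun x => (\sum_(a : (beta |` A)%fset)
              (c a)%:E * abs_monomial (val a) x)%dE.

Definition even_AG_cone (R : realType) (n : nat) (A : {fset 'rV[R]_n})
    (beta : 'rV[R]_n) : set ('rV[R]_n -> \bar R) :=
  [set f | exists c : {ffun (beta |` A)%fset -> R},
    [/\ forall a, val a \in A -> 0 <= c a,
        f = AG_function c &
        forall x, (0 <= f x)%E]].

Definition even_AG_dual_cone (R : realType) (n : nat) (A : {fset 'rV[R]_n})
    (beta : 'rV[R]_n) : set {ffun (beta |` A)%fset -> R} :=
  [set v | forall f, even_AG_cone A beta f ->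
     forall c : {ffun (beta |` A)%fset -> R}, f = AG_function c ->
       0 <= \sum_a v a * c a].

Arguments even_AG_dual_cone {R n} A beta _ : assert.

Definition possemidef (R : realType) (N : nat) (M : 'M[R]_N) : Prop :=
  M^T = M /\ forall x : 'cV[R]_N, 0 <= (x^T *m M *m x) 0 0.

Definition block (R : realType) : Type := {k : nat & 'M[R]_k}.

Definition block1 (R : realType) (a : R) : block R :=
  existT (fun k => 'M[R]_k) 1%N a%:M.

(* The block with rows (a b) and (b d). *)
Definition block2 (R : realType) (a b d : R) : block R :=
  existT (fun k => 'M[R]_k) 2%N
    (\matrix_(i < 2, j < 2) if i != j then b else if i == 0 then a else d).

Definition block_diagonal (R : realType) (s : seq (block R)) :
    'M[R]_(\sum_(i < size s) projT1 (nth (block1 0) s i)) :=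
  \mxdiag_(i < size s) projT2 (nth (block1 0) s i).

(* The pairs (k, i) with 1 <= k <= m - 1 and 1 <= i <= 2 ^ (m - k). *)
Definition y_index (m : nat) : {fset nat * nat} :=
  [fset ki in [seq (k, i) | k <- iota 1 m.-1, i <- iota 1 (2 ^ (m - k))]]%fset.

(* s lists the diagonal entries of the 2 ^ (m - 1) blocks with off-diagonal
   entry y_(1, l): those of the first block, then those of the second, etc. *)
Definition arrangement (R : realType) (n : nat) (A : {fset 'rV[R]_n})
    (beta : 'rV[R]_n) (num : {ffun A -> nat}) (p m : nat)
    (s : (2 ^ m).-tuple (beta |` A)%fset) : Prop :=
  (forall a : A, count (fun b => val b == val a) s = num a) /\
  count (fun b => val b == beta) s = (2 ^ m - p)%N.

(* If p = 2 then m = 1, and an arrangement s lists the two elements of A. *)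
Definition dual_circuit_blocks (R : realType) (n : nat) (A : {fset 'rV[R]_n})
    (beta : 'rV[R]_n) (p m : nat) (s : (2 ^ m).-tuple (beta |` A)%fset)
    (v : {ffun (beta |` A)%fset -> R}) (y : {ffun y_index m -> R}) :
    seq (block R) :=
  let vb := coordinate v beta in
  let vs := [seq v a | a <- s] in
  let Y k i := coordinate y (k, i) in
  if p == 2%N then [:: block2 vs`_0 vb vs`_1; block1 vb]
  else
    [seq block2 (Y k.-1 i.*2.-1) (Y k i) (Y k.-1 i.*2)
       | k <- iota 2 (m - 2), i <- iota 1 (2 ^ (m - k))]
    ++ [:: block2 (Y m.-1 1%N) vb (Y m.-1 2%N); block1 vb]
    ++ [seq block2 vs`_(l.*2 - 2) (Y 1%N l) vs`_(l.*2 - 1)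
          | l <- iota 1 (2 ^ m.-1)].

Definition dual_circuit_spectrahedron (R : realType) (n : nat)
    (AA A : {fset 'rV[R]_n}) (beta : 'rV[R]_n) (p m : nat)
    (s : (2 ^ m).-tuple (beta |` A)%fset) :
    set ({ffun AA -> R} * {ffun y_index m -> R}) :=
  [set vy | possemidef (block_diagonal
     (dual_circuit_blocks p s (restrict_coordinates (beta |` A)%fset vy.1) vy.2))].

Arguments dual_circuit_spectrahedron {R n} AA {A beta} p {m} s _ : assert.

Definition norm2 (R : realType) (r : nat) (z : 'cV[R]_r) : R :=
  Num.sqrt (\sum_i z i 0 ^+ 2).

Definition socp_feasible (R : realType) (N M : nat) (r : 'I_M -> nat)
    (A : forall i, 'M[R]_(r i, N)) (b : forall i, 'cV[R]_(r i))
    (c : 'I_M -> 'cV[R]_N) (d : 'I_M -> R) : set 'cV[R]_N :=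
  [set x | forall i, norm2 (A i *m x + b i) <= ((c i)^T *m x) 0 0 + d i].

(* S is the projection of a second-order cone feasible set on the coordinates
   rho t, t : T. *)
Definition second_order_representable (R : realType) (T : finType)
    (S : set {ffun T -> R}) : Prop :=
  exists (N M : nat) (r : 'I_M -> nat) (A : forall i, 'M[R]_(r i, N))
    (b : forall i, 'cV[R]_(r i)) (c : 'I_M -> 'cV[R]_N) (d : 'I_M -> R)
    (rho : T -> 'I_N),
    injective rho /\
    S = [set [ffun t => x (rho t) 0] | x in socp_feasible A b c d].

(* Main.v *)
(** By the weighted AM-GM inequality and affine independence of A, the dual cone
   is the set of v >= 0 with v_beta^p <= prod_a v_a^(p_a); here all p_a are
   positive because beta lies in the relative interior. Homogenizing, for
   v_beta > 0 this says v_beta^(2^m) <= v_beta^(2^m - p) * prod_a v_a^(p_a), an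
   inequality between v_beta and the geometric mean of 2^m numbers. Placing
   these at the leaves of a complete binary tree, each inner node bounded by the
   geometric mean of its two children, splits it into 2 x 2 positive
   semidefinite conditions, and each of these is a second-order cone condition:
   b^2 <= a d with a, d >= 0 iff |(2b, a - d)| <= a + d. *)
Require Import Defs.
From HB Require Import structures.
From mathcomp Require Import all_boot all_order all_algebra.
From mathcomp Require Import finmap.
From mathcomp Require Import all_classical all_reals all_analysis.
From mathcomp Require Import zify ring lra.

Set Implicit Arguments.
Unset Strict Implicit.
Unset Printing Implicit Defensive.

Import Order.TTheory GRing.Theory Num.Theory.
Import numFieldNormedType.Exports.

Local Open Scope classical_set_scope.
Local Open Scope ring_scope.

(** * Sums over finite sets, weighted AM-GM *)

Section GeneralFacts.

Lemma big_fsetU1_val (R : Type) (idx : R) (op : Monoid.com_law idx)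
    (K : choiceType) (b : K) (A : {fset K}) (F : K -> R) : b \notin A ->
  \big[op/idx]_(x : (b |` A)%fset) F (val x) =
  op (F b) (\big[op/idx]_(x : A) F (val x)).
Proof.
by move=> bA; rewrite -(big_seq_fsetE op _ xpredT) big_fsetU1// big_seq_fsetE.
Qed.

Lemma coordinate_val (R : realType) (K : choiceType) (X : {fset K})
    (x : {ffun X -> R}) (k : X) : coordinate x (val k) = x k.
Proof. by rewrite /coordinate valK. Qed.

Lemma coordinate_finfun (R : realType) (K : choiceType) (X : {fset K})
    (g : K -> R) (k : K) : k \in X ->
  coordinate [ffun x : X => g (val x)] k = g k.
Proof. by move=> kX; rewrite /coordinate insubT /= ffunE. Qed.

Lemma prod_count_mem (R : comPzSemiRingType) (T : finType) (F : T -> R)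
    (s : seq T) :
  \prod_(b <- s) F b = \prod_b F b ^+ count_mem b s.
Proof.
elim: s => [|c s IH]; first by rewrite big_nil big1.
rewrite big_cons IH (bigD1 c)//= [RHS](bigD1 c)//= eqxx exprS mulrA.
congr (_ * _); apply: eq_bigr => b bc.
by rewrite eq_sym (negPf bc).
Qed.

(** The unweighted inequality is applied to the family in which each index i is repeated [w i]
    times, indexed by the pairs (i, j) with j < [w i]. *)
Lemma weighted_AGM (R : numFieldType) (I : finType) (w : I -> nat)
    (E : I -> R) (p := (\sum_i w i)%N) : (forall i, 0 <= E i) ->
  \prod_i E i ^+ w i <= (\sum_i (w i)%:R * E i / p%:R) ^+ p.
Proof.
move=> E0; pose J : finType := {i : I & 'I_(w i)}.
have cardJ : #|J| = p.
  rewrite card_tagged sumnE big_map big_enum /=.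
  by apply: eq_bigr => i _; rewrite card_ord.
have [AGM _] := leif_AGM (A := {: J}) (E := fun q => E (tag q)) (fun q _ => E0 (tag q)).
rewrite /= cardJ in AGM.
have prodE : \prod_(q : J) E (tag q) = \prod_i E i ^+ w i.
  have -> : \prod_(q : J) E (tag q) = \prod_i \prod_(j < w i) E i by rewrite sig_big_dep.
  by apply: eq_bigr => i _; rewrite prodr_const card_ord.
have sumE : \sum_(q : J) E (tag q) / p%:R = \sum_i (w i)%:R * E i / p%:R.
  have -> : \sum_(q : J) E (tag q) / p%:R = \sum_i \sum_(j < w i) E i / p%:R.
    by rewrite sig_big_dep.
  by apply: eq_bigr => i _; rewrite sumr_const card_ord -mulrA mulr_natl.
by rewrite -prodE -sumE -mulr_suml.
Qed.

Lemma nthroot_exists (R : realType) (p : nat) (x : R) : (0 < p)%N -> 0 <= x ->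
  exists2 w : R, 0 <= w & w ^+ p = x.
Proof.
move=> p0 x0; exists (x `^ p%:R^-1); first exact: powR_ge0.
rewrite -powR_mulrn ?powR_ge0// -powRrM mulVf ?powRr1//.
by rewrite pnatr_eq0 -lt0n.
Qed.

(** Replaces a limit e -> 0. The bound e <= 1 allows callers to estimate powers of e by e. *)
Lemma ge0_perturbed (R : realFieldType) (a M : R) :
  (forall e, 0 < e <= 1 -> 0 <= a + e * M) -> 0 <= a.
Proof.
move=> H; rewrite leNgt; apply/negP => a0.
have [M0|M0] := leP M 0.
  by have := H 1; rewrite ltr01 lexx mul1r => /(_ isT); lra.
have D0 : 0 < M - a by lra.
(* For a < 0 < M this e lies in (0, 1), and a + e M = - a^2 / (M - a) < 0. *)
have e0 : 0 < - a / (M - a) by rewrite divr_gt0//; lra.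
have := H (- a / (M - a)); rewrite e0 ler_pdivrMr// mul1r => /(_ ltac:(lra)).
have -> : a + - a / (M - a) * M = - a ^+ 2 / (M - a).
  apply: (mulIf (lt0r_neq0 D0)); rewrite mulfVK ?lt0r_neq0// mulrDl.
  by rewrite mulrAC mulfVK ?lt0r_neq0//; ring.
rewrite pmulr_lge0 ?invr_gt0// oppr_ge0 => h.
by have := exprn_even_gt0 (n := 2) a isT; rewrite (lt_eqF a0) /= => /esym; lra.
Qed.

End GeneralFacts.
(** * Barycentric coordinates *)

Section Barycentric.
Variables (R : realType) (n : nat) (A : {fset 'rV[R]_n}).
Hypothesis A_indep : affinely_independent A.

Lemma barycentric_uniq (x : 'rV[R]_n) (c d : {ffun A -> R}) :
  barycentric x c -> barycentric x d -> c = d.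
Proof.
move=> [cx c1] [dx d1]; apply/ffunP => a; apply/eqP; rewrite -subr_eq0.
have := A_indep (c := [ffun a => c a - d a]) _ _ a; rewrite ffunE => -> //.
- by rewrite (eq_bigr (fun a => c a - d a)) => [|b _]; rewrite ?ffunE// sumrB c1 d1 subrr.
- rewrite (eq_bigr (fun a => c a *: val a - d a *: val a)) => [|b _].
    by rewrite sumrB cx dx subrr.
  by rewrite ffunE scalerBl.
Qed.

(** A convex combination may list a point of A several times; its weights are added up over the
    fibres of [t]. *)
Lemma convex_hull_barycentric (x : 'rV[R]_n) : convex_hull [set` A] x ->
  exists2 mu : {ffun A -> R}, forall a, 0 <= mu a & barycentric x mu.
Proof.
move=> [k [l [s [sA l0 l1 ->]]]].
pose t i : A := FSetSub (sA i).
exists [ffun a => \sum_(i | t i == a) l i] => [a|].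
  by rewrite ffunE sumr_ge0.
split; last first.
  by rewrite -l1 (partition_big t xpredT)//=; apply: eq_bigr => a _; rewrite ffunE.
rewrite [RHS](partition_big t xpredT)//=; apply: eq_bigr => a _.
by rewrite ffunE scaler_suml; apply: eq_bigr => i /eqP <-.
Qed.

Lemma convex_hull_mem (a : A) : convex_hull [set` A] (val a).
Proof.
exists 1%N, (fun=> 1), (fun=> val a); split => //.
- by move=> i; exact: valP.
- by rewrite big_ord1.
- by rewrite big_ord1 scale1r.
Qed.

(* If some coordinate of beta vanished, beta + t (beta - a) would leave the
   convex hull of A for every t > 0 without leaving the affine hull. *)
Lemma relint_barycentric_gt0 (beta : 'rV[R]_n) (lam : {ffun A -> R}) :
  relint (convex_hull [set` A]) beta -> barycentric beta lam ->
  forall a, 0 < lam a.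
Proof.
move=> [conv_beta near_beta] lamE a.
have [mu mu0 muE] := convex_hull_barycentric conv_beta.
have lam0 b : 0 <= lam b by rewrite (barycentric_uniq lamE muE).
rewrite lt_neqAle lam0 andbT eq_sym; apply/eqP => lama.
pose y (t : R) : 'rV[R]_n := beta + t *: (beta - val a).
have y_cvg : y @ (0 : R) --> beta.
  rewrite -[X in _ --> X](_ : y 0 = beta); last by rewrite /y scale0r addr0.
  apply: cvgD; first exact: cvg_cst.
  by apply: cvgZr_tmp; exact: cvg_id.
have : \forall t \near (0 : R), affine_hull (convex_hull [set` A]) (y t) ->
    convex_hull [set` A] (y t) by exact: (y_cvg _ near_beta).
case/nbhs_ballP => e /= e0 He.
have e20 : 0 < e / 2 by rewrite divr_gt0.
have conv_y : convex_hull [set` A] (y (e / 2)).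
  apply: He; first by rewrite /ball /= sub0r normrN gtr0_norm//; lra.
  exists 2%N, (fun i => if i == ord0 then 1 + e / 2 else - (e / 2)),
    (fun i => if i == ord0 then beta else val a); split.
  + by move=> i; case: ifP => // _; exact: convex_hull_mem.
  + by rewrite !big_ord_recl big_ord0 /=; lra.
  + rewrite !big_ord_recl big_ord0 /= addr0 /y scalerBr scalerDl scale1r.
    by rewrite scaleNr addrA.
- have [nu nu0 nuE] := convex_hull_barycentric conv_y.
  (* As [lam a] = 0, these coordinates take the value - e / 2 at a, which membership in the hull
     forbids. *)
  have lamE' : barycentric (y (e / 2))
      [ffun b => lam b + e / 2 * (lam b - (b == a)%:R)].
    have [lamx lam1] := lamE; split.
      rewrite (eq_bigr (fun b => lam b *: val b +
        e / 2 *: (lam b *: val b - (b == a)%:R *: val b))) => [|b _]; last first.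
        by rewrite ffunE scalerDl -(scalerA (e / 2)) scalerBl.
      rewrite big_split /= lamx -scaler_sumr sumrB lamx; congr (_ + _ *: (_ - _)).
      rewrite (bigD1 a)//= eqxx scale1r big1 ?addr0// => b /negPf ->.
      by rewrite scale0r.
    under eq_bigr do rewrite ffunE.
    rewrite big_split /= lam1 -mulr_sumr sumrB lam1 (bigD1 a)//= eqxx.
    by rewrite big1 => [|b /negPf -> //]; rewrite addr0 subrr mulr0 addr0.
  have := nu0 a; rewrite (barycentric_uniq nuE lamE') ffunE lama eqxx /= mulr1n; lra.
Qed.

(** Affine independence is linear independence of the rows (a, 1), so their matrix has a right
    inverse; applied to g, it gives an affine function with linear part y and constant term t. *)
Lemma affinely_independent_interpolation (g : A -> R) :
  exists (y : 'rV[R]_n) (t : R),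
    forall a : A, \sum_j val a 0 j * y 0 j + t = g a.
Proof.
pose M : 'M[R]_(#|{: A}|, n + 1) := row_mx (\matrix_i val (enum_val i)) (const_mx 1).
have Mfree : row_free M.
  apply: inj_row_free => v; rewrite mul_mx_row.
  rewrite -[X in _ = X]row_mx0 => /eq_row_mx[v0 v1].
  pose c : {ffun A -> R} := [ffun a => v 0 (enum_rank a)].
  have c0 : forall a, c a = 0.
    apply: A_indep.
    - rewrite (reindex (@enum_val _ {: A})) /=; last exact: onW_bij (enum_val_bij _).
      have := congr1 (fun v : 'M[R]_1 => v 0 0) v1.
      rewrite mxE [RHS]mxE => v1'; rewrite -[RHS]v1'.
      by apply: eq_bigr => i _; rewrite ffunE enum_valK mxE mulr1.
    - rewrite (reindex (@enum_val _ {: A})) /=; last exact: onW_bij (enum_val_bij _).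
      rewrite -[RHS]v0 mulmx_sum_row; apply: eq_bigr => i _.
      by rewrite ffunE enum_valK rowK.
  by apply/rowP => i; rewrite mxE -[RHS](c0 (enum_val i)) ffunE enum_valK.
have [B MB] := row_freeP Mfree.
pose z := B *m (\col_i g (enum_val i)).
exists (\row_j z (lshift 1 j) 0), (z (rshift n ord0) 0) => a.
have : (M *m z) (enum_rank a) 0 = g a.
  by rewrite mulmxA MB mul1mx mxE enum_rankK.
rewrite mxE big_split_ord /= big_ord1 => <-.
congr (_ + _); last by rewrite row_mxEr [const_mx _ _ _]mxE mul1r.
by apply: eq_bigr => j _; rewrite row_mxEl !mxE enum_rankK.
Qed.

End Barycentric.
(** * The dual cone as a power cone *)

Section AGFunctions.
Import DualAddTheory.
Variables (R : realType) (n : nat).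

Lemma abs_monomial_expR (alpha y : 'rV[R]_n) :
  abs_monomial alpha (\row_j expR (y 0 j)) =
  (expR (\sum_j alpha 0 j * y 0 j))%:E.
Proof.
rewrite /abs_monomial ifF.
  rewrite expR_sum; congr (_%:E); apply: eq_bigr => j _.
  by rewrite mxE ger0_norm ?expR_ge0// mulrC expRM.
by apply/existsP => -[j]; rewrite mxE (gt_eqF (expR_gt0 _)).
Qed.

Lemma AG_functionE (A : {fset 'rV[R]_n}) (beta : 'rV[R]_n)
    (c : {ffun (beta |` A)%fset -> R}) (x : 'rV[R]_n) (z : 'rV[R]_n -> R) :
  beta \notin A -> (forall a : (beta |` A)%fset, abs_monomial (val a) x = (z (val a))%:E) ->
  AG_function c x = (coordinate c beta * z beta +
    \sum_(a : A) coordinate c (val a) * z (val a))%:E.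
Proof.
move=> bA zE; rewrite /AG_function.
rewrite (eq_bigr (fun a => (coordinate c (val a) * z (val a))%:E)) => [|a _]; last first.
  by rewrite zE coordinate_val.
by rewrite dsumEFin (big_fsetU1_val _ (fun k => coordinate c k * z k)).
Qed.

End AGFunctions.

Section CircuitCone.
Import DualAddTheory.
Variables (R : realType) (n : nat) (A : {fset 'rV[R]_n}) (beta : 'rV[R]_n).
Variables (p : nat) (num : {ffun A -> nat}).
Hypotheses (A_indep : affinely_independent A) (betaA : beta \notin A).
Hypotheses (p_gt1 : (1 < p)%N) (num_gt0 : forall a, (0 < num a)%N).
Hypothesis sum_num : (\sum_a num a)%N = p.
Hypothesis sum_num_vec : \sum_a (num a)%:R *: val a = p%:R *: beta.

Let T := (beta |` A)%fset.
Let p_gt0 : (0 < p)%N := ltnW p_gt1.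
Let pR_gt0 : 0 < p%:R :> R. Proof. by rewrite ltr0n. Qed.

Let betaT : beta \in T. Proof. exact: fset1U1. Qed.
Let valT (a : A) : val a \in T. Proof. exact/fset1Ur/valP. Qed.

Lemma sum_num_coord j : p%:R * beta 0 j = \sum_a (num a)%:R * val a 0 j.
Proof.
have := congr1 (fun u : 'rV[R]_n => u 0 j) sum_num_vec.
by rewrite summxE mxE => <-; apply: eq_bigr => a _; rewrite mxE.
Qed.

(* The monomials |x|^a on the positive orthant take, up to a common factor
   exp t, every positive value u by affine independence; the value w at beta is
   then their weighted geometric mean. *)
Lemma AG_function_ge0_mean (c : {ffun T -> R}) (u : A -> R) (w : R) :
  (forall x, (0 <= AG_function c x)%E) -> (forall a, 0 < u a) -> 0 <= w ->
  w ^+ p = \prod_a u a ^+ num a ->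
  0 <= coordinate c beta * w + \sum_(a : A) coordinate c (val a) * u a.
Proof.
move=> f0 u0 w0 wp.
have [y [t yt]] := affinely_independent_interpolation A_indep (fun a => ln (u a)).
have := f0 (\row_j expR (y 0 j)).
rewrite (AG_functionE (z := fun a => expR (\sum_j a 0 j * y 0 j)) _ betaA) => [|a]; last first.
  exact: abs_monomial_expR.
(* The positive factor exp t turns the monomial at each a into [u a]. *)
rewrite lee_fin -(pmulr_lge0 _ (expR_gt0 t)) mulrDl mulr_suml -mulrA -expRD.
have -> : \sum_(a : A) coordinate c (val a) * expR (\sum_j val a 0 j * y 0 j) * expR t =
    \sum_(a : A) coordinate c (val a) * u a.
  by apply: eq_bigr => a _; rewrite -mulrA -expRD yt lnK ?posrE.
suff -> : expR (\sum_j beta 0 j * y 0 j + t) = w by [].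
(* After taking p-th powers the exponents agree: the linear parts by [sum_num_vec], the multiples of
   t by [sum_num]. *)
apply: (pexpIrn p_gt0); rewrite ?nnegrE ?expR_ge0// wp -expRM_natl.
rewrite (eq_bigr (fun a => expR ((num a)%:R * (\sum_j val a 0 j * y 0 j + t)))) => [|a _]; last first.
  by rewrite yt expRM_natl lnK// posrE.
rewrite -expR_sum; congr expR.
under [RHS]eq_bigr do rewrite mulrDr.
rewrite mulrDr big_split /= -mulr_suml -natr_sum sum_num; congr (_ + _).
under [RHS]eq_bigr do rewrite mulr_sumr.
rewrite exchange_big mulr_sumr; apply: eq_bigr => j _ /=.
by rewrite mulrA sum_num_coord mulr_suml; apply: eq_bigr => a _; rewrite mulrA.
Qed.

(** The dual cone pairs with every coefficient vector of f, so the signs must follow from f >= 0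
    alone. With value 1 at a and e^p at the other points of A, the value at beta is e^(p - [num a]),
    and only the term at a survives as e tends to 0. *)
Lemma AG_function_coef_ge0 (c : {ffun T -> R}) :
  (forall x, (0 <= AG_function c x)%E) -> forall a : A, 0 <= coordinate c (val a).
Proof.
move=> f0 a.
pose M := `|coordinate c beta| + \sum_(b | b != a) `|coordinate c (val b)|.
apply: (@ge0_perturbed _ _ M) => e /andP[e0 e1].
have num_le : (num a <= p)%N by rewrite -sum_num (bigD1 a)//= leq_addr.
(* If [num a] = p then A = {a}, hence beta = a, which is excluded; so p - [num a] is positive. *)
have [/eqP num_p|num_neq] := boolP (num a == p).
  have A1 b : b = a.
    apply/eqP/negPn/negP => ba; have := num_gt0 b.
    by move: sum_num; rewrite (bigD1 a)//= num_p (bigD1 b)//=; lia.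
  have := sum_num_vec; rewrite (bigD1 a)//= big1 => [|b]; last by rewrite (A1 b) eqxx.
  rewrite addr0 num_p => /(scalerI (lt0r_neq0 pR_gt0)) ab.
  by move: betaA; rewrite -ab => /negP; case; exact: valP.
have num_lt : (num a < p)%N by rewrite ltn_neqAle num_neq.
have : 0 <= coordinate c beta * e ^+ (p - num a) +
    \sum_(b : A) coordinate c (val b) * (if b == a then 1 else e ^+ p).
  apply: AG_function_ge0_mean => // [b||].
  - by case: ifP => // _; rewrite exprn_gt0.
  - by rewrite exprn_ge0// ltW.
  - rewrite (bigD1 a)//= eqxx expr1n mul1r.
    rewrite (eq_bigr (fun b => e ^+ (p * num b))) => [|b /negPf ->]; last by rewrite exprM.
    rewrite prodrXr -exprM -big_distrr /=; congr (e ^+ _).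
    by rewrite mulnC; congr (_ * _)%N; rewrite -sum_num (bigD1 a)//= addKn.
rewrite (bigD1 a)//= eqxx mulr1 => h.
apply: le_trans h _; rewrite addrCA lerD2l /M mulrDr mulr_sumr; apply: lerD.
  apply: le_trans (ler_norm _) _; rewrite normrM mulrC ler_wpM2r//.
  rewrite ger0_norm ?exprn_ge0 ?(ltW e0)//.
  by rewrite -(prednK (n := p - num a)) ?subn_gt0// exprS ler_piMr ?exprn_ile1// ltW.
apply: ler_sum => b /negPf ->; apply: le_trans (ler_norm _) _.
rewrite normrM mulrC ler_wpM2r// ger0_norm ?exprn_ge0 ?(ltW e0)//.
by rewrite -(prednK p_gt0) exprS ler_piMr ?exprn_ile1// ltW.
Qed.

(* Total even at the zeros of x: a vanishing x_j either occurs in no exponent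
   or makes both sides vanish. *)
Lemma abs_monomial_mean (x : 'rV[R]_n) (z := fun a : 'rV[R]_n => \prod_j `|x 0 j| `^ a 0 j) :
  (forall (a : A) j, x 0 j = 0 -> 0 <= val a 0 j) ->
  z beta ^+ p = \prod_(a : A) z (val a) ^+ num a.
Proof.
move=> a_ge0; rewrite /z -prodrXl.
under [RHS]eq_bigr do rewrite -prodrXl.
rewrite exchange_big /=; apply: eq_bigr => j _.
have powX (r : R) k : (`|x 0 j| `^ r) ^+ k = `|x 0 j| `^ (k%:R * r).
  by rewrite -powR_mulrn ?powR_ge0// -powRrM mulrC.
under [RHS]eq_bigr do rewrite powX.
rewrite powX sum_num_coord.
have [xj|xj] := eqVneq (x 0 j) 0; last first.
  have x0 : 0 < `|x 0 j| by rewrite normr_gt0.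
  rewrite -[X in X `^ _]lnK ?posrE// -expRM mulr_sumr expR_sum.
  by apply: eq_bigr => a _; rewrite expRM lnK ?posrE.
have na0 (a : A) : 0 <= (num a)%:R * val a 0 j by rewrite mulr_ge0// a_ge0.
rewrite xj normr0.
(* The terms are nonnegative. If they sum to 0, all of them vanish and every power is 0^0 = 1;
   otherwise some factor on the right is 0, as is the left side. *)
have [s0|s0] := eqVneq (\sum_(a : A) (num a)%:R * val a 0 j) 0.
  rewrite s0 powRr0 big1// => a _.
  move/eqP: s0; rewrite psumr_eq0// => /allP/(_ a); rewrite mem_index_enum => /(_ isT).
  by move=> /eqP ->; rewrite powRr0.
rewrite powR0//; apply/esym/eqP; rewrite prodf_seq_eq0.
move: s0; rewrite psumr_eq0// => /allPn[a _ /= ha].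
by apply/hasP; exists a; rewrite ?mem_index_enum//= powR0.
Qed.

(** The functional c vanishes at the boundary point (u, w) of the power cone, as the weights [num a]
    / p sum to 1. Nonnegativity is weighted AM-GM for the quotients of the monomials by the
    [u a]. *)
Lemma AG_circuit_ge0 (u : A -> R) (w : R) (c : {ffun T -> R}) :
  (forall a, 0 < u a) -> 0 < w -> w ^+ p = \prod_a u a ^+ num a ->
  coordinate c beta = - w^-1 ->
  (forall a : A, coordinate c (val a) = (num a)%:R / (p%:R * u a)) ->
  forall x, (0 <= AG_function c x)%E.
Proof.
move=> u0 w0 wp cb ca x.
(* The coefficient at a is positive, so one infinite monomial makes the dual sum +oo, whatever the
   term at beta is. *)
have [/existsP[a /eqP aoo]|noo] := boolP [exists a : A, abs_monomial (val a) x == +oo%E].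
  suff -> : AG_function c x = +oo%E by [].
  apply/eqP; rewrite /AG_function desum_eqy; apply/exists_inP.
  exists (FSetSub (valT a)) => //=; rewrite aoo -coordinate_val ca.
  by rewrite gt0_muley// lte_fin divr_gt0 ?mulr_gt0// ltr0n.
pose z (a : 'rV[R]_n) := \prod_j `|x 0 j| `^ a 0 j.
have a_ge0 (a : A) j : x 0 j = 0 -> 0 <= val a 0 j.
  move=> xj; rewrite leNgt; apply/negP => aj.
  move/existsP: noo; apply; exists a; rewrite /abs_monomial ifT//.
  by apply/existsP; exists j; rewrite xj eqxx.
(* The exponents of beta are weighted means of those of A, so the monomial at beta is finite as
   well. *)
have b_ge0 j : x 0 j = 0 -> 0 <= beta 0 j.
  move=> xj; rewrite -(pmulr_rge0 _ pR_gt0) sum_num_coord sumr_ge0// => a _.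
  by rewrite mulr_ge0// a_ge0.
rewrite (AG_functionE (z := z) _ betaA); last first.
  move=> [a aT] /=; rewrite /abs_monomial ifF//; apply/existsP => -[j /andP[/eqP xj]].
  move: aT; rewrite in_fset1U => /predU1P[->|aA]; rewrite ltNge.
    by rewrite b_ge0.
  by rewrite (a_ge0 (FSetSub aA)).
have z0 a : 0 <= z a by rewrite prodr_ge0// => j _; exact: powR_ge0.
have zmean := abs_monomial_mean a_ge0.
rewrite lee_fin cb mulNr addrC subr_ge0.
have -> : \sum_(a : A) coordinate c (val a) * z (val a) =
    \sum_(a : A) (num a)%:R * (z (val a) / u a) / p%:R.
  by apply: eq_bigr => a _; rewrite ca invfM; ring.
rewrite -(@ler_pXn2r _ p) ?nnegrE//; last 2 first.
- by rewrite mulr_ge0// invr_ge0 ltW.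
- by rewrite sumr_ge0// => a _; rewrite !mulr_ge0 ?invr_ge0// ltW.
have := @weighted_AGM _ _ num (fun a => z (val a) / u a).
rewrite sum_num => AGM; apply: le_trans (AGM _) => [|a]; last by rewrite divr_ge0// ltW.
rewrite exprMn exprVn wp zmean mulrC -prodfV -big_split /= le_eqVlt.
by apply/orP; left; apply/eqP/eq_bigr => a _; rewrite exprMn exprVn.
Qed.

Definition circuit_power_cone : set {ffun T -> R} :=
  [set v | [/\ forall a : A, 0 <= coordinate v (val a), 0 <= coordinate v beta &
    coordinate v beta ^+ p <= \prod_(a : A) coordinate v (val a) ^+ num a]].

Lemma dual_pairing (v c : {ffun T -> R}) :
  \sum_a v a * c a = coordinate v beta * coordinate c beta +
    \sum_(a : A) coordinate v (val a) * coordinate c (val a).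
Proof.
rewrite -(big_fsetU1_val _ (fun k => coordinate v k * coordinate c k))//.
by apply: eq_bigr => a _; rewrite !coordinate_val.
Qed.

(** Only c_beta < 0 is critical. Raising each v_a by e > 0 makes it a value [u a] that f can attain
    up to scaling; the mean w is then at least v_beta, so the pairing is at least - e times the sum
    of the c_a. *)
Lemma circuit_power_cone_sub : circuit_power_cone `<=` even_AG_dual_cone A beta.
Proof.
move=> v [v0 vb0 vbp] f [_ [_ _ f0]] c fE.
rewrite fE in f0; have c0 := AG_function_coef_ge0 f0.
rewrite dual_pairing; have [cb0|cb0] := leP 0 (coordinate c beta).
  by rewrite addr_ge0 ?mulr_ge0// sumr_ge0// => a _; rewrite mulr_ge0.
apply: (@ge0_perturbed _ _ (\sum_(a : A) coordinate c (val a))) => e /andP[e0 _].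
pose u (a : A) := coordinate v (val a) + e.
have u0 a : 0 < u a by rewrite ltr_wpDl.
have [w w0 wp] : exists2 w : R, 0 <= w & w ^+ p = \prod_a u a ^+ num a.
  by apply: nthroot_exists => //; rewrite prodr_ge0// => a _; rewrite exprn_ge0// ltW.
have vbw : coordinate v beta <= w.
  rewrite -(@ler_pXn2r _ p) ?nnegrE// wp; apply: le_trans vbp _.
  apply: ler_prod => a _; apply/andP; split; first exact: exprn_ge0.
  by rewrite lerXn2r ?nnegrE ?v0 ?(ltW (u0 a))// /u lerDl ltW.
apply: le_trans (AG_function_ge0_mean f0 u0 w0 wp) _.
have -> : \sum_(a : A) coordinate c (val a) * u a =
  \sum_(a : A) coordinate v (val a) * coordinate c (val a) +
    e * \sum_(a : A) coordinate c (val a).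
  rewrite mulr_sumr -big_split /=; apply: eq_bigr => a _; rewrite /u; ring.
rewrite addrA lerD2r lerD2r mulrC; nra.
Qed.

(** Functions with a single coefficient 1 give v >= 0. The functions of [AG_circuit_ge0] at u_a =
    v_a + e give v_beta / w <= 1 with w the weighted geometric mean of u; then e tends to 0. *)
Lemma even_AG_dual_cone_sub : even_AG_dual_cone A beta `<=` circuit_power_cone.
Proof.
move=> v v_dual.
have pos_dual (c : {ffun T -> R}) : (forall a : T, 0 <= c a) -> 0 <= \sum_a v a * c a.
  move=> c0; apply: (v_dual (AG_function c)) => //; exists c; split => // x.
  apply: dsume_ge0 => a _; rewrite mule_ge0 ?lee_fin// /abs_monomial.
  by case: ifP => // _; rewrite lee_fin prodr_ge0// => j _; exact: powR_ge0.
have v0 (a : T) : 0 <= v a.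
  have := pos_dual [ffun b => (b == a)%:R].
  rewrite (bigD1 a)//= ffunE eqxx mulr1 big1 => [|b /negPf ba]; last first.
    by rewrite ffunE ba mulr0.
  by rewrite addr0; apply => b; rewrite ffunE.
have v0' k : 0 <= coordinate v k.
  by rewrite /coordinate; case: insubP => //= b _ _; exact: v0.
split => //.
(* The bound as a polynomial in e, so that the limit at 0 is continuity of polynomials. *)
pose P : {poly R} := \prod_(a : A) ((coordinate v (val a))%:P + 'X) ^+ num a.
have PE e : P.[e] = \prod_(a : A) (coordinate v (val a) + e) ^+ num a.
  by rewrite horner_prod; apply: eq_bigr => a _; rewrite horner_exp hornerD hornerC hornerX.
suff P_ge e : 0 < e -> coordinate v beta ^+ p <= P.[e].
  have -> : \prod_(a : A) coordinate v (val a) ^+ num a = P.[0].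
    by rewrite PE; apply: eq_bigr => a _; rewrite addr0.
  have cvgP : (fun e => P.[e]) e @[e --> 0^'+] --> P.[0].
    apply: cvg_at_right_filter; exact: continuous_horner.
  apply: (closed_cvg (fun y => coordinate v beta ^+ p <= y) (@closed_ge R _) _ _ cvgP).
  by near=> e; apply: P_ge; near: e; exact: nbhs_right_gt.
move=> e0; rewrite PE; pose u (a : A) := coordinate v (val a) + e.
have u0 a : 0 < u a by rewrite ltr_wpDl.
have Pu0 : 0 < \prod_a u a ^+ num a by rewrite prodr_gt0// => a _; rewrite exprn_gt0.
have [w w0 wp] : exists2 w : R, 0 <= w & w ^+ p = \prod_a u a ^+ num a.
  exact: nthroot_exists p_gt0 (ltW Pu0).
have {}w0 : 0 < w.
  by rewrite lt_neqAle w0 andbT; apply: contraTneq Pu0 => w_0; rewrite -wp -w_0 expr0n gtn_eqF// ltxx.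
pose g (k : 'rV[R]_n) := if insub k is Some a then (num a)%:R / (p%:R * u a) else - w^-1.
pose c : {ffun T -> R} := [ffun k => g (val k)].
have cb : coordinate c beta = - w^-1 by rewrite coordinate_finfun// /g insubN.
have ca (a : A) : coordinate c (val a) = (num a)%:R / (p%:R * u a).
  by rewrite coordinate_finfun// /g valK.
have : 0 <= \sum_a v a * c a.
  apply: (v_dual (AG_function c)) => //; exists c; split => //; last first.
    exact: AG_circuit_ge0 u0 w0 wp cb ca.
  move=> k kA; rewrite ffunE /g insubT /=.
  by rewrite divr_ge0// mulr_ge0// ltW.
rewrite dual_pairing cb mulrN addrC subr_ge0 => h.
have vw1 : coordinate v beta / w <= 1.
  apply: le_trans h _.
  apply: (@le_trans _ _ (\sum_a (num a)%:R / p%:R)); last first.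
    by rewrite -mulr_suml -natr_sum sum_num mulfV// lt0r_neq0.
  apply: ler_sum => a _; rewrite ca invfM mulrCA ler_wpM2l// mulrCA ger_pMr ?invr_gt0//.
  by rewrite ler_pdivrMr// mul1r lerDl ltW.
rewrite -wp lerXn2r ?nnegrE ?(ltW w0)//.
by move: vw1; rewrite ler_pdivrMr// mul1r.
Unshelve. all: by end_near.
Qed.

Lemma even_AG_dual_coneE : even_AG_dual_cone A beta = circuit_power_cone.
Proof.
apply/seteqP; split; [exact: even_AG_dual_cone_sub|exact: circuit_power_cone_sub].
Qed.

End CircuitCone.
(** * Positive semidefinite blocks and second-order cones *)

Section PSD.
Variable R : realType.

Definition psd2 (a b d : R) : Prop := [/\ 0 <= a, 0 <= d & b ^+ 2 <= a * d].

(** Lets a list of [psd2] triples also carry the 1 x 1 block. *)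
Lemma psd2_diag (a : R) : psd2 a a a <-> 0 <= a.
Proof. by split=> [[]//|a0]; split => //; rewrite expr2. Qed.

Lemma possemidef_block1 (a : R) : possemidef (projT2 (block1 a)) <-> 0 <= a.
Proof.
rewrite /possemidef /=; split=> [[_ /(_ 1%:M)]|a0].
  by rewrite trmx1 mul1mx mulmx1 mxE eqxx.
split=> [|x]; first by rewrite tr_scalar_mx.
rewrite mul_mx_scalar -scalemxAl mxE mxE big_ord1 mxE.
by rewrite mulr_ge0// -expr2 sqr_ge0.
Qed.

Lemma block2_form (a b d : R) (x : 'cV[R]_2) :
  (x^T *m projT2 (block2 a b d) *m x) 0 0 =
  a * x 0 0 ^+ 2 + 2 * b * x 0 0 * x 1 0 + d * x 1 0 ^+ 2.
Proof.
rewrite !mxE !big_ord_recl big_ord0 !mxE !big_ord_recl !big_ord0 !mxE /=.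
by rewrite (_ : lift ord0 ord0 = 1); [ring|exact/val_inj].
Qed.

Lemma possemidef_block2 (a b d : R) :
  possemidef (projT2 (block2 a b d)) <-> psd2 a b d.
Proof.
split=> [[_ pos]|[a0 d0 bad]].
  have form u w : 0 <= a * u ^+ 2 + 2 * b * u * w + d * w ^+ 2.
    have := pos (\col_i (if i == 0 then u else w)).
    by rewrite block2_form !mxE.
  have a0 : 0 <= a by have := form 1 0; lra.
  have d0 : 0 <= d by have := form 0 1; lra.
  split => //; move: a0; rewrite le_eqVlt => /predU1P[a0|a0].
    have [->|b0] := eqVneq b 0; first by rewrite expr0n /= -a0 mul0r.
    (* With a = 0 the form takes the value - (d + 1) + d = - 1 here. *)
    have := form (- (d + 1) / (2 * b)) 1; rewrite -a0 mul0r add0r !mulr1.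
    by rewrite mulrCA mulfV ?mulf_neq0// expr1n; lra.
  (* The value of the form at (- b, a) is a (a d - b^2). *)
  by have := form (- b) a; nra.
split.
  by apply/matrixP => i j; rewrite !mxE eq_sym; case: eqP => // ->.
move=> x; rewrite block2_form; set u := x 0 0; set w := x 1 0.
move: a0; rewrite le_eqVlt => /predU1P[a0|a0].
  have b0 : b = 0.
    apply/eqP; rewrite -sqrf_eq0 eq_le sqr_ge0 andbT.
    by apply: le_trans bad _; rewrite -a0 mul0r.
  by rewrite -a0 b0 mul0r mulr0 !mul0r !add0r mulr_ge0// sqr_ge0.
rewrite -(pmulr_rge0 _ a0).
have -> : a * (a * u ^+ 2 + 2 * b * u * w + d * w ^+ 2) =
  (a * u + b * w) ^+ 2 + (a * d - b ^+ 2) * w ^+ 2 by ring.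
by rewrite addr_ge0 ?sqr_ge0// mulr_ge0 ?sqr_ge0// subr_ge0.
Qed.

Lemma possemidef_mxdiag (k : nat) (q : 'I_k -> nat)
    (B : forall i, 'M[R]_(q i)) :
  possemidef (\mxdiag_i B i) <-> forall i, possemidef (B i).
Proof.
have form (x : forall i, 'cV[R]_(q i)) :
    ((\mxcol_i x i)^T *m \mxdiag_i B i *m \mxcol_i x i) 0 0 =
    \sum_i ((x i)^T *m B i *m x i) 0 0.
  rewrite -mulmxA mul_mxdiag_mxcol tr_mxcol mul_mxrow_mxcol summxE.
  by apply: eq_bigr => i _; rewrite mulmxA.
split=> [[sym pos] i|pos].
  split; first by move: sym; rewrite tr_mxdiag => /eq_mxdiagP/(_ i).
  (* The vector x placed in block i, with 0 elsewhere; [conform_mx] settles the sizes, which depend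
     on j. *)
  move=> x; have := pos (\mxcol_j (conform_mx (0 : 'cV[R]_(q j)) (if j == i then x else 0 : 'cV_(q i)))).
  rewrite form (bigD1 i)//= eqxx conform_mx_id big1 ?addr0// => j /negPf ji.
  suff conform0 h h' : conform_mx (0 : 'cV[R]_h) (0 : 'cV_h') = 0.
    by rewrite ji conform0 mulmx0 mxE.
  have [<-|ne] := eqVneq h' h; first by rewrite conform_mx_id.
  by rewrite nonconform_mx// ne.
split; first by rewrite tr_mxdiag; apply/eq_mxdiagP => i; case: (pos i).
move=> x; rewrite -[x]submxcolK form sumr_ge0// => i _; exact: (pos i).2.
Qed.

Lemma possemidef_block_diagonal (s : seq (block R)) :
  possemidef (block_diagonal s) <->
  all (fun b => `[< possemidef (projT2 b) >]) s.
Proof.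
rewrite /block_diagonal possemidef_mxdiag; split=> [pos|/(all_nthP (block1 0)) pos i].
  by apply/(all_nthP (block1 0)) => i si; apply/asboolP; exact: (pos (Ordinal si)).
by apply/asboolP; exact: pos.
Qed.

End PSD.

Section SecondOrder.
Variable R : realType.

Lemma psd2_second_order (a b d : R) :
  psd2 a b d <-> Num.sqrt ((2 * b) ^+ 2 + (a - d) ^+ 2) <= a + d.
Proof.
have E : (2 * b) ^+ 2 + (a - d) ^+ 2 = (a + d) ^+ 2 - 4 * (a * d - b ^+ 2) by ring.
have [ad0|ad0] := leP 0 (a + d); last first.
  split=> [[a0 d0 _]|h]; first by move: ad0; lra.
  by have := le_trans (sqrtr_ge0 _) h; lra.
rewrite -[X in _ <= X](ger0_norm ad0) -sqrtr_sqr ler_sqrt ?sqr_ge0// E.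
split=> [[a0 d0 bad]|h]; first by lra.
have bad : b ^+ 2 <= a * d by lra.
have adge : 0 <= a * d by exact: le_trans (sqr_ge0 b) bad.
(* A nonnegative product and a nonnegative sum leave no negative factor. *)
split => //; rewrite leNgt; apply/negP => neg; nra.
Qed.

(** I indexes all variables and f selects those kept by the projection. Each triple (a, b, d)
    becomes one cone with rows 2b and a - d and right side a + d. *)
Lemma second_order_representable_psd2 (T I : finType) (f : T -> I)
    (L : seq (I * I * I)) : injective f ->
  second_order_representable
    [set v : {ffun T -> R} | exists x : I -> R, (forall t, v t = x (f t)) /\
       forall q, q \in L -> psd2 (x q.1.1) (x q.1.2) (x q.2)].
Proof.
move=> f_inj.
pose q (i : 'I_(size L)) := tnth (in_tuple L) i.
pose e (j : I) : 'rV[R]_#|I| := delta_mx 0 (enum_rank j).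
pose x_ (x : 'cV[R]_#|I|) j := x (enum_rank j) 0.
have eE j x : (e j *m x) 0 0 = x_ x j.
  by rewrite /e -rowE mxE.
have eD j k x : ((e j + e k) *m x) 0 0 = x_ x j + x_ x k.
  by rewrite mulmxDl mxE !eE.
have eB j k x : ((e j - e k) *m x) 0 0 = x_ x j - x_ x k.
  by rewrite mulmxBl mxE [X in _ + X]mxE !eE.
have eZ c j x : ((c *: e j) *m x) 0 0 = c * x_ x j.
  by rewrite -scalemxAl mxE eE.
exists #|I|, (size L), (fun=> 2%N),
  (fun i => \matrix_(k < 2) if k == 0 then 2 *: e (q i).1.2 else e (q i).1.1 - e (q i).2),
  (fun=> 0), (fun i => (e (q i).1.1 + e (q i).2)^T), (fun=> 0), (fun t => enum_rank (f t)).
have feas x : socp_feasible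
  (fun i => \matrix_(k < 2) if k == 0 then 2 *: e (q i).1.2 else e (q i).1.1 - e (q i).2)
  (fun=> 0) (fun i => (e (q i).1.1 + e (q i).2)^T) (fun=> 0) x <->
  forall r, r \in L -> psd2 (x_ x r.1.1) (x_ x r.1.2) (x_ x r.2).
  rewrite /socp_feasible /=.
  have one i : norm2 ((\matrix_(k < 2) if k == 0 then 2 *: e (q i).1.2 else e (q i).1.1 - e (q i).2) *m x + 0)
      <= ((e (q i).1.1 + e (q i).2)^T^T *m x) 0 0 + 0 <->
      psd2 (x_ x (q i).1.1) (x_ x (q i).1.2) (x_ x (q i).2).
    have rowE k : ((\matrix_(k < 2) if k == 0 then 2 *: e (q i).1.2 else e (q i).1.1 - e (q i).2) *m x) k 0 =
      ((if k == 0 then 2 *: e (q i).1.2 else e (q i).1.1 - e (q i).2) *m x) 0 0.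
      by rewrite mxE [RHS]mxE; apply: eq_bigr => j _; rewrite mxE.
    rewrite psd2_second_order trmxK !addr0 eD /norm2 !big_ord_recl big_ord0 addr0.
    by rewrite !rowE /= eZ eB.
  split=> [H r rL|H i].
    by have /tnthP[i ->] : r \in in_tuple L by []; exact/one/H.
  by apply/one/H; exact: mem_tnth.
split; first by move=> s t /enum_rank_inj/f_inj.
apply/seteqP; split=> v /=.
  move=> [x [vx Hx]].
  exists (\col_i x (enum_val i)).
    by apply/feas => r /Hx; rewrite /x_ !mxE !enum_rankK.
  by apply/ffunP => t; rewrite ffunE mxE enum_rankK vx.
move=> [x /feas Hx <-]; exists (x_ x); split => // t; by rewrite ffunE.
Qed.

End SecondOrder.
(** * Binary trees of geometric means *)

Section Tree.
Variable R : realType.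

(** [N k i] is the i-th node at height k, counted from 1: the leaves are at height 0, the root is
    (m, 1), and the children of (k, i) are (k - 1, 2i - 1) and (k - 1, 2i). *)
Definition psd_tree (m : nat) (N : nat -> nat -> R) : Prop :=
  forall k i, (0 < k <= m)%N -> (0 < i <= 2 ^ (m - k))%N ->
    psd2 (N k.-1 i.*2.-1) (N k i) (N k.-1 i.*2).

Lemma psd_tree_child m k i : (0 < k <= m)%N -> (0 < i <= 2 ^ (m - k))%N ->
  [/\ (k.-1 <= m)%N, (0 < i.*2.-1 <= 2 ^ (m - k.-1))%N &
      (0 < i.*2 <= 2 ^ (m - k.-1))%N].
Proof.
move=> /andP[k0 km] /andP[i0 im].
have e : (m - k.-1 = (m - k).+1)%N by rewrite -subSn// -(prednK k0) subSS.
by rewrite e expnS mul2n; split; lia.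
Qed.

Lemma eq_psd_tree m (N N' : nat -> nat -> R) :
  (forall k i, (k <= m)%N -> (0 < i <= 2 ^ (m - k))%N -> N k i = N' k i) ->
  psd_tree m N -> psd_tree m N'.
Proof.
move=> NN' H k i hk hi; have [km h1 h2] := psd_tree_child hk hi.
by rewrite -!NN'//; [exact: H|case/andP: hk].
Qed.

(** Leaf i is a diagonal entry of the condition at its parent, node [uphalf i] at height 1. *)
Lemma psd_tree_leaf_ge0 m (N : nat -> nat -> R) : (0 < m)%N -> psd_tree m N ->
  forall i, (0 < i <= 2 ^ m)%N -> 0 <= N 0 i.
Proof.
case: m => // m _ H i hi.
have hi2 : (0 < uphalf i <= 2 ^ (m.+1 - 1))%N.
  by rewrite subSS subn0; move: hi; rewrite expnS mul2n; lia.
have [/=] := H 1%N (uphalf i) isT hi2.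
have [io|io] := boolP (odd i).
  by rewrite (_ : (uphalf i).*2.-1 = i)//; lia.
by rewrite (_ : (uphalf i).*2 = i)//; lia.
Qed.

(** The leaves below node (k + 1, i) split into those below its two children. *)
Lemma prod_dyadic (x : nat -> R) k i : (0 < i)%N ->
  \prod_(i.-1 * 2 ^ k.+1 <= j < i * 2 ^ k.+1) x j =
  (\prod_(i.*2.-1.-1 * 2 ^ k <= j < i.*2.-1 * 2 ^ k) x j) *
  \prod_(i.*2.-1 * 2 ^ k <= j < i.*2 * 2 ^ k) x j.
Proof.
case: i => // i _; rewrite -big_cat_nat /=.
- by rewrite expnS !mulnA !muln2.
- by rewrite leq_mul2r; lia.
- by rewrite leq_mul2r; lia.
Qed.

Lemma psd_tree_le m (N : nat -> nat -> R) : (0 < m)%N -> psd_tree m N ->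
  0 <= N m 1%N -> N m 1%N ^+ (2 ^ m) <= \prod_(0 <= j < 2 ^ m) N 0%N j.+1.
Proof.
move=> m0 H Nm.
(* A condition does not bound its off-diagonal entry from below, so the sign is assumed at the node
   itself; its children are nonnegative as diagonal entries. *)
have main k i : (k <= m)%N -> (0 < i <= 2 ^ (m - k))%N -> 0 <= N k i ->
    N k i ^+ (2 ^ k) <= \prod_(i.-1 * 2 ^ k <= j < i * 2 ^ k) N 0%N j.+1.
  elim: k i => [|k IH] i km hi Nk.
    by case: i hi {Nk} => // i _; rewrite !muln1 big_nat1.
  have [_ h1 h2] := psd_tree_child (k := k.+1) km hi.
  have [a0 d0 bad] := H k.+1 i km hi.
  rewrite prod_dyadic ?(andP hi).1// expnS exprM.
  apply: (@le_trans _ _ ((N k i.*2.-1 * N k i.*2) ^+ (2 ^ k))).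
    by rewrite lerXn2r// ?nnegrE ?sqr_ge0// mulr_ge0.
  rewrite exprMn; apply: ler_pM; rewrite ?exprn_ge0//; apply: IH => //; exact: ltnW.
by have := main m 1%N (leqnn _); rewrite subnn mul0n mul1n; exact.
Qed.

(** The tree with equality at every node. Leaves count from 1 and x from 0, whence [i.-1]. *)
Fixpoint geometric_tree (x : nat -> R) (k i : nat) : R :=
  if k is k'.+1 then
    Num.sqrt (geometric_tree x k' i.*2.-1 * geometric_tree x k' i.*2)
  else x i.-1.

Lemma geometric_tree_ge0 (x : nat -> R) k i : (forall j, 0 <= x j) ->
  0 <= geometric_tree x k i.
Proof. by case: k => [|k] x0 //=; rewrite sqrtr_ge0. Qed.

Lemma geometric_treeX (x : nat -> R) k i : (forall j, 0 <= x j) -> (0 < i)%N ->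
  geometric_tree x k i ^+ (2 ^ k) =
  \prod_(i.-1 * 2 ^ k <= j < i * 2 ^ k) x j.
Proof.
move=> x0; elim: k i => [|k IH] i i0.
  by case: i i0 => // i _; rewrite !muln1 big_nat1.
rewrite prod_dyadic// expnS exprM /= sqr_sqrtr ?mulr_ge0 ?geometric_tree_ge0//.
by rewrite exprMn !IH//; lia.
Qed.

(** The tree of geometric means with its root lowered to b. Only the condition at the root changes,
    and b is at most the old root by comparing 2^m-th powers. *)
Lemma psd_tree_exists m (x : nat -> R) (b : R) : (0 < m)%N ->
  (forall j, 0 <= x j) -> 0 <= b -> b ^+ (2 ^ m) <= \prod_(0 <= j < 2 ^ m) x j ->
  exists N, [/\ psd_tree m N, forall i, N 0%N i = x i.-1 & N m 1%N = b].
Proof.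
move=> m0 x0 b0 bx; pose G := geometric_tree x.
exists (fun k i => if k == m then b else G k i); split.
- move=> k i /andP[k0 km] hi.
  have -> : (k.-1 == m) = false by lia.
  have Gsqr : G k i ^+ 2 = G k.-1 i.*2.-1 * G k.-1 i.*2.
    rewrite -(prednK k0) /G /= sqr_sqrtr// mulr_ge0//; exact: geometric_tree_ge0.
  split; [exact: geometric_tree_ge0..|].
  case: eqP => [k_m|_]; last by rewrite Gsqr.
  move: hi; rewrite k_m subnn expn0 => hi; have i1 : i = 1%N by lia.
  rewrite -k_m -Gsqr lerXn2r// ?nnegrE//; first exact: geometric_tree_ge0.
  rewrite -(@ler_pXn2r _ (2 ^ m)%N) ?nnegrE ?expn_gt0//; last exact: geometric_tree_ge0.
  by rewrite i1 k_m /G geometric_treeX// mul0n mul1n.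
- by move=> i; case: eqP => // m_0; move: m0; rewrite -m_0.
- by rewrite eqxx.
Qed.

End Tree.
(** * The dual circuit spectrahedron *)

Section Spectrahedron.
Variables (R : realType) (n : nat) (A : {fset 'rV[R]_n}) (beta : 'rV[R]_n).
Variables (p m : nat) (s : (2 ^ m).-tuple (beta |` A)%fset).

(** Reads the entries of the dual circuit matrix as a tree: s labels the leaves, v_beta is the root,
    y fills the heights between. *)
Definition circuit_node (v : {ffun (beta |` A)%fset -> R})
    (y : {ffun y_index m -> R}) (k i : nat) : R :=
  if k == 0%N then [seq v a | a <- s]`_i.-1
  else if k == m then coordinate v beta else coordinate y (k, i).

Lemma all_psd_allpairs (f g h : nat -> nat -> R) (k0 r : nat) (j : nat -> nat) :
  all (fun b => `[< possemidef (projT2 b) >])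
    [seq block2 (f k i) (g k i) (h k i) | k <- iota k0 r, i <- iota 1 (j k)] <->
  forall k i, (k0 <= k < k0 + r)%N -> (0 < i <= j k)%N ->
    psd2 (f k i) (g k i) (h k i).
Proof.
split=> [/all_allpairsP H k i hk hi|H].
  by apply/possemidef_block2/asboolP/H; rewrite mem_iota// add1n ltnS.
apply/all_allpairsP => k i; rewrite !mem_iota add1n ltnS => hk hi.
by apply/asboolP/possemidef_block2/H.
Qed.

Lemma all_psd_map (f g h : nat -> R) (r : nat) :
  all (fun b => `[< possemidef (projT2 b) >])
    [seq block2 (f i) (g i) (h i) | i <- iota 1 r] <->
  forall i, (0 < i <= r)%N -> psd2 (f i) (g i) (h i).
Proof.
rewrite all_map; split=> [/allP H i hi|H].
  by apply/possemidef_block2/asboolP/H; rewrite mem_iota add1n ltnS.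
apply/allP => i; rewrite mem_iota add1n ltnS => hi /=.
by apply/asboolP/possemidef_block2/H.
Qed.

(** The 2 x 2 blocks are the conditions at heights 2 to m - 1, at the root and at height 1, in this
    order; the 1 x 1 block is the sign of v_beta. For p = 2 the root sits directly above the two
    leaves. *)
Lemma possemidef_dual_circuit (v : {ffun (beta |` A)%fset -> R})
    (y : {ffun y_index m -> R}) : (1 < p)%N -> m = up_log 2 p ->
  possemidef (block_diagonal (dual_circuit_blocks p s v y)) <->
  0 <= coordinate v beta /\ psd_tree m (circuit_node v y).
Proof.
move=> p1 mE; rewrite possemidef_block_diagonal /dual_circuit_blocks.
have [p2|pN2] := eqVneq p 2%N.
  have m1 : m = 1%N by rewrite mE p2.
  have m1b : (1 == m)%N by rewrite m1.
  rewrite /= andbT; split.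
    move=> /andP[/asboolP/possemidef_block2 h2 /asboolP/possemidef_block1 h1].
    split => // k i; rewrite {1 2}m1 => hk; have -> : k = 1%N by lia.
    rewrite subnn expn0 => hi; have -> : i = 1%N by lia.
    by rewrite /circuit_node /= m1b.
  move=> [h1 h2]; apply/andP; split; apply/asboolP; last exact/possemidef_block1.
  apply/possemidef_block2; have := h2 1%N 1%N; rewrite {1 2}m1 => /(_ isT isT).
  by rewrite /circuit_node /= m1b.
have m2 : (2 <= m)%N.
  rewrite ltnNge; apply/negP => m1; have := up_logP p (isT : (1 < 2)%N).
  rewrite -mE => pm; have := leq_trans pm (leq_pexp2l (isT : (0 < 2)%N) m1).
  by move: p1 pN2; rewrite expn1; lia.
rewrite !all_cat /= andbT; split.
  move=> /and3P[/all_psd_allpairs h1 /andP[/asboolP/possemidef_block2 h2 /asboolP/possemidef_block1 h3] /all_psd_map h4].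
  split => // k i hk hi; rewrite /circuit_node.
  have -> : (k == 0)%N = false by lia.
  have -> : (k.-1 == m) = false by lia.
  have [k_1|k1] := eqVneq k 1%N.
    rewrite k_1 /= ifF; last by lia.
    have := h4 i; rewrite k_1 subn1 in hi => /(_ hi).
    by rewrite subn2 subn1.
  have -> : (k.-1 == 0)%N = false by lia.
  have [k_m|km] := eqVneq k m.
    by move: hi; rewrite k_m subnn expn0 => hi; have -> : i = 1%N by lia.
  by apply: h1 => //; lia.
move=> [h0 H]; apply/and3P; split.
- apply/all_psd_allpairs => k i hk hi.
  have hk' : (0 < k <= m)%N by lia.
  have := H k i hk' hi; rewrite /circuit_node.
  rewrite (_ : (k == 0)%N = false); last by lia.
  rewrite (_ : (k.-1 == m) = false); last by lia.
  rewrite (_ : (k.-1 == 0)%N = false); last by lia.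
  by rewrite (_ : (k == m) = false); last by lia.
- apply/andP; split; apply/asboolP; last exact/possemidef_block1.
  apply/possemidef_block2.
  have hk' : (0 < m <= m)%N by lia.
  have := H m 1%N hk'; rewrite subnn expn0 => /(_ isT); rewrite /circuit_node eqxx.
  rewrite (_ : (m == 0)%N = false); last by lia.
  rewrite (_ : (m.-1 == m) = false); last by lia.
  by rewrite (_ : (m.-1 == 0)%N = false); last by lia.
- apply/all_psd_map => i hi.
  have hk' : (0 < 1 <= m)%N by lia.
  have := H 1%N i hk'; rewrite subn1 => /(_ hi); rewrite /circuit_node /=.
  rewrite (_ : (1 == m)%N = false); last by lia.
  by rewrite subn2 subn1.
Qed.

Lemma mem_y_index k i :
  ((k, i) \in y_index m) = [&& (0 < k)%N, (k < m)%N & (0 < i <= 2 ^ (m - k))%N].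
Proof.
rewrite /y_index in_fset /=; apply/idP/idP.
  move=> /allpairsPdep[k' [i' [hk hi [-> ->]]]].
  by move: hk hi; rewrite !mem_iota; lia.
move=> /and3P[k0 km hi]; apply/allpairsPdep; exists k, i.
by rewrite !mem_iota add1n ltnS; split => //; lia.
Qed.

Lemma prod_leaves (num : {ffun A -> nat}) (v : {ffun (beta |` A)%fset -> R}) :
  beta \notin A -> arrangement num p s ->
  \prod_(0 <= j < 2 ^ m) [seq v a | a <- s]`_j =
  coordinate v beta ^+ (2 ^ m - p) *
  \prod_(a : A) coordinate v (val a) ^+ num a.
Proof.
move=> bA [s_num s_beta].
rewrite -{1}(size_tuple s) -(size_map v s) -(big_nth 0 xpredT id) big_map.
rewrite prod_count_mem.
pose cnt (k : 'rV[R]_n) := count (fun b => val b == k) s.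
rewrite (eq_bigr (fun b => coordinate v (val b) ^+ cnt (val b))) => [|b _]; last first.
  by rewrite coordinate_val; congr (_ ^+ _); apply: eq_count => c; rewrite /= val_eqE.
rewrite (big_fsetU1_val _ (fun k => coordinate v k ^+ cnt k))// /cnt s_beta.
by congr (_ * _); apply: eq_bigr => a _; rewrite s_num.
Qed.

(** Multiplying the power inequality by v_beta^(2^m - p) makes its right side the product of all
    leaves. *)
Lemma circuit_power_cone_tree (num : {ffun A -> nat})
    (v : {ffun (beta |` A)%fset -> R}) :
  beta \notin A -> (0 < m)%N -> (0 < p <= 2 ^ m)%N -> (forall a, (0 < num a)%N) ->
  arrangement num p s ->
  circuit_power_cone p num v <->
  exists y, 0 <= coordinate v beta /\ psd_tree m (circuit_node v y).
Proof.
move=> bA m0 /andP[p0 pm] num0 hs.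
have leaves := prod_leaves v bA hs; set vs := [seq v a | a <- s] in leaves.
have sz : size vs = (2 ^ m)%N by rewrite size_map size_tuple.
have v0E : (forall a : A, 0 <= coordinate v (val a)) -> 0 <= coordinate v beta ->
    forall b, 0 <= v b.
  move=> va vb b; rewrite -coordinate_val.
  have : val b \in (beta |` A)%fset by exact: valP.
  by rewrite in_fset1U => /predU1P[->//|bA']; exact: (va (FSetSub bA')).
split=> [[va vb vbp]|[y [vb H]]].
  have [|||N [NH Nleaf Nroot]] := @psd_tree_exists R m (fun j => vs`_j) (coordinate v beta) m0.
  - move=> j; have [jm|jm] := ltnP j (size vs); last by rewrite nth_default.
    have : vs`_j \in vs by exact: mem_nth.
    by move=> /mapP[b _ ->]; exact: v0E.
  - by [].
  - rewrite leaves -{1}(subnK pm) exprD.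
    by apply: ler_wpM2l => //; exact: exprn_ge0.
  exists [ffun ki => N (val ki).1 (val ki).2]; split => //.
  apply: eq_psd_tree NH => k i km hi; rewrite /circuit_node.
  case: eqP => [->|k0]; first by rewrite Nleaf.
  case: eqP => [k_m|kNm].
    by move: hi; rewrite k_m subnn expn0 => hi; rewrite (_ : i = 1%N)//; lia.
  rewrite (coordinate_finfun (fun ki => N ki.1 ki.2))//.
  by rewrite mem_y_index; apply/and3P; split => //; lia.
have v_ge0 b : b \in tval s -> 0 <= v b.
  move=> bs; have := psd_tree_leaf_ge0 m0 H (i := (index (v b) vs).+1).
  rewrite /circuit_node /= nth_index ?map_f//; apply.
  by rewrite -sz index_mem map_f.
have [s_num _] := hs.
(* Since [num a] > 0, every a labels some leaf. *)
have va (a : A) : 0 <= coordinate v (val a).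
  have : has (fun b => val b == val a) s by rewrite has_count s_num.
  by move=> /hasP[b bs /eqP <-]; rewrite coordinate_val; exact: v_ge0.
have := psd_tree_le m0 H.
rewrite {1 2}/circuit_node eqxx (gtn_eqF m0) => /(_ vb).
have -> : \prod_(0 <= j < 2 ^ m) circuit_node v y 0 j.+1 = \prod_(0 <= j < 2 ^ m) vs`_j.
  by apply: eq_bigr.
rewrite leaves => h; split => //.
(* The factor v_beta^(2^m - p) cancels if v_beta > 0; if v_beta = 0, the left side of the goal is 0
   because p > 0. *)
move: vb; rewrite le_eqVlt => /predU1P[vb|vb].
  rewrite -vb expr0n (gtn_eqF p0) /=.
  by rewrite prodr_ge0// => a _; rewrite exprn_ge0 ?va.
move: h; rewrite -{1}(subnK pm) exprD ler_pM2l//; exact: exprn_gt0.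
Qed.

Lemma spectrahedron_projection (AA : {fset 'rV[R]_n}) (num : {ffun A -> nat}) :
  (A `<=` AA)%fset -> beta \in AA -> beta \notin A -> (1 < p)%N ->
  m = up_log 2 p -> (forall a, (0 < num a)%N) -> arrangement num p s ->
  circuit_power_cone p num = [set restrict_coordinates (beta |` A)%fset vy.1
    | vy in dual_circuit_spectrahedron AA p s].
Proof.
move=> AAA bAA bA p1 mE num0 hs.
have m0 : (0 < m)%N by rewrite mE up_log_gt0.
have pm : (0 < p <= 2 ^ m)%N by rewrite mE up_logP// andbT ltnW.
apply/seteqP; split=> v /=.
  move=> /(circuit_power_cone_tree v bA m0 pm num0 hs)[y Hy].
  (* The lift to AA extends v by 0, the default value of [coordinate]. *)
  have restrictK : restrict_coordinates (beta |` A)%fset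
      [ffun k : AA => coordinate v (val k)] = v.
    apply/ffunP => k; rewrite ffunE (coordinate_finfun (coordinate v)).
      by rewrite coordinate_val.
    by have := valP k; rewrite in_fset1U => /predU1P[->//|/(fsubsetP AAA)].
  exists ([ffun k : AA => coordinate v (val k)], y); last exact: restrictK.
  by rewrite /dual_circuit_spectrahedron /= restrictK; apply/possemidef_dual_circuit.
move=> [[w y] /= /possemidef_dual_circuit H <-].
by apply/(circuit_power_cone_tree _ bA m0 pm num0 hs); exists y; exact: H.
Qed.

Lemma second_order_representable_power_cone (num : {ffun A -> nat}) :
  beta \notin A -> (1 < p)%N -> m = up_log 2 p -> (forall a, (0 < num a)%N) ->
  arrangement num p s ->
  second_order_representable (circuit_power_cone (beta := beta) p num).
Proof.
move=> bA p1 mE num0 hs.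
have m0 : (0 < m)%N by rewrite mE up_log_gt0.
have pm : (0 < p <= 2 ^ m)%N by rewrite mE up_logP// andbT ltnW.
pose T := (beta |` A)%fset; pose I : finType := (T + y_index m)%type.
pose b0 : T := FSetSub (fset1U1 beta A).
(* Names the variable at each position of [circuit_node]; the final [inl b0] is a default outside
   the index range of y. *)
pose node k i : I := if k == 0%N then inl (nth b0 s i.-1)
  else if k == m then inl b0 else if insub (k, i) is Some z then inr z else inl b0.
pose L : seq (I * I * I) := (inl b0, inl b0, inl b0) ::
  [seq (node k.-1 i.*2.-1, node k i, node k.-1 i.*2)
    | k <- iota 1 m, i <- iota 1 (2 ^ (m - k))].
have LP (x : I -> R) : (forall q, q \in L -> psd2 (x q.1.1) (x q.1.2) (x q.2)) <->
    0 <= x (inl b0) /\ psd_tree m (fun k i => x (node k i)).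
  split=> [H|[x0 H] q].
    split; first by apply/psd2_diag; apply: (H (_, _, _)); exact: mem_head.
    move=> k i hk hi; apply: (H (_, _, _)); rewrite inE; apply/orP; right.
    apply/allpairsPdep; exists k, i; rewrite !mem_iota; split => //; lia.
  rewrite inE => /predU1P[->|/allpairsPdep[k [i []]]]; first exact/psd2_diag.
  by rewrite !mem_iota => hk hi ->; apply: H; lia.
have nodeE (x : I -> R) (v : {ffun T -> R}) (y : {ffun y_index m -> R}) :
    (forall t, v t = x (inl t)) -> (forall z, y z = x (inr z)) ->
    forall k i, (k <= m)%N -> (0 < i <= 2 ^ (m - k))%N ->
    x (node k i) = circuit_node v y k i.
  move=> xv xy k i km hi; rewrite /node /circuit_node.
  case: eqP => [k0|k0].
    by rewrite (nth_map b0) -?xv// size_tuple; move: hi; rewrite k0 subn0; lia.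
  case: eqP => [k_m|kNm]; first by rewrite -xv -(coordinate_val v b0).
  have kiy : (k, i) \in y_index m by rewrite mem_y_index; apply/and3P; split => //; lia.
  by rewrite /coordinate insubT /= xy.
have vb0 (v : {ffun T -> R}) : coordinate v beta = v b0 by rewrite -(coordinate_val v b0).
have -> : circuit_power_cone (beta := beta) p num =
    [set v : {ffun T -> R} | exists x : I -> R, (forall t, v t = x (inl t)) /\
       forall q, q \in L -> psd2 (x q.1.1) (x q.1.2) (x q.2)].
  apply/seteqP; split=> v /=.
    move=> /(circuit_power_cone_tree v bA m0 pm num0 hs)[y [vb Hy]].
    pose x (j : I) : R := match j with inl t => v t | inr z => y z end.
    exists x; split => //; apply/LP; split; first by rewrite /= -vb0.
    by apply: eq_psd_tree Hy => k i km hi; rewrite (nodeE x v y).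
  move=> [x [xv /LP[xb Hx]]]; apply/(circuit_power_cone_tree _ bA m0 pm num0 hs).
  exists [ffun z => x (inr z)]; split; first by rewrite vb0 xv.
  by apply: eq_psd_tree Hx => k i km hi; apply: nodeE => // z; rewrite ffunE.
by apply: second_order_representable_psd2 => t t' [].
Qed.

End Spectrahedron.

(** Second-order representability is claimed without a given arrangement, so one is built: [num a]
    copies of each a, then beta up to length 2^m. *)
Lemma arrangement_exists (R : realType) (n : nat) (A : {fset 'rV[R]_n})
    (beta : 'rV[R]_n) (num : {ffun A -> nat}) (p m : nat) :
  beta \notin A -> (\sum_a num a)%N = p -> (p <= 2 ^ m)%N ->
  exists s : (2 ^ m).-tuple (beta |` A)%fset, arrangement num p s.
Proof.
move=> bA sum_num pm; pose T := (beta |` A)%fset.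
pose inA (a : A) : T := FSetSub (fset1Ur beta (valP a)).
pose b0 : T := FSetSub (fset1U1 beta A).
pose s0 := flatten [seq nseq (num a) (inA a) | a <- enum {: A}].
have count_s0 (P : pred T) : count P s0 = (\sum_(a : A) P (inA a) * num a)%N.
  rewrite count_flatten -map_comp sumnE big_map big_enum /=.
  by apply: eq_bigr => a _; rewrite count_nseq.
pose s := s0 ++ nseq (2 ^ m - p) b0.
have sz : size s == (2 ^ m)%N.
  rewrite -count_predT count_cat count_s0 count_nseq /= mul1n.
  by under eq_bigr do rewrite mul1n; rewrite sum_num subnKC.
have beta_val (a : A) : (beta == val a) = false.
  by apply: contraNF bA => /eqP ->; exact: valP.
exists (Tuple sz); rewrite /arrangement /s; split=> [a|].
  rewrite /= count_cat count_s0 count_nseq /= beta_val mul0n addn0.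
  rewrite (bigD1 a)//= eqxx mul1n big1 ?addn0// => b ba.
  by rewrite val_eqE (negPf ba).
rewrite /= count_cat count_s0 count_nseq /= eqxx mul1n big1// => a _.
by rewrite eq_sym beta_val.
Qed.
Theorem theorem3p3 (R : realType) (n : nat) (AA A : {fset 'rV[R]_n})
    (beta : 'rV[R]_n) (lam : {ffun A -> R}) (p : nat) (num : {ffun A -> nat})
    (m : nat) (AA_neq0 : AA != fset0)
    (A_circuit : circuits AA (A, beta))
    (lamE : barycentric beta lam)
    (pE : smallest_common_denominator lam p)
    (numE : forall a, lam a = (num a)%:R / p%:R)
    (mE : m = up_log 2 p) :
  (forall s : (2 ^ m).-tuple (beta |` A)%fset, arrangement num p s ->
     even_AG_dual_cone A beta =
     [set restrict_coordinates (beta |` A)%fset vy.1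
        | vy in dual_circuit_spectrahedron AA p s]) /\
  second_order_representable (even_AG_dual_cone A beta).
Proof.
move: A_circuit => [/= AAA A_indep beta_relint]; rewrite inE => /andP[betaA betaAA].
have [[p_gt0 _] _] := pE; have pR0 : p%:R != 0 :> R by rewrite pnatr_eq0 -lt0n.
have num_gt0 a : (0 < num a)%N.
  have := relint_barycentric_gt0 A_indep beta_relint lamE a.
  by rewrite numE lt0n; apply: contraTneq => ->; rewrite mul0r ltxx.
have [lam_vec lam_sum] := lamE.
have sum_num : (\sum_a num a)%N = p.
  apply/eqP; rewrite -(eqr_nat R) natr_sum -[X in X == _](mulfVK pR0) mulr_suml.
  under eq_bigr do rewrite -numE.
  by rewrite lam_sum mul1r.
have sum_num_vec : \sum_a (num a)%:R *: val a = p%:R *: beta.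
  rewrite -lam_vec scaler_sumr; apply: eq_bigr => a _.
  by rewrite scalerA numE mulrC mulfVK.
(* If p = 1, the positive numerators leave a single a with [num a] = 1, so that beta = a lies in
   A. *)
have p_gt1 : (1 < p)%N.
  rewrite ltn_neqAle p_gt0 andbT eq_sym; apply/eqP => p1.
  have [a _|noA] := pickP (xpredT : pred A); last first.
    by move: p_gt0; rewrite -sum_num big1// => a; have := noA a.
  have only_a b : b != a -> False.
    move=> ba; move: sum_num (num_gt0 a) (num_gt0 b).
    by rewrite p1 (bigD1 a)//= (bigD1 b)//=; lia.
  move: sum_num_vec sum_num; rewrite (bigD1 a)//= big1 => [|b /only_a//].
  rewrite [in X in _ -> X](bigD1 a)//= big1 => [|b /only_a//].
  rewrite addr0 addn0 => + num_a; rewrite num_a => /(scalerI pR0) beta_a.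
  by move: betaA; rewrite -beta_a; move/negP; apply; exact: valP.
have -> := even_AG_dual_coneE A_indep betaA p_gt1 num_gt0 sum_num sum_num_vec.
split=> [s hs|]; first exact: spectrahedron_projection.
have pm : (p <= 2 ^ m)%N by rewrite mE up_logP.
have [s hs] := arrangement_exists betaA sum_num pm.
exact: second_order_representable_power_cone hs.
Qed.
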